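(* Let $n,d$ be positive integers with $1\le d<\frac{n-1}{2}$ and let $g=\gcd(2d+1,n)$. Then the multiplicity of $-1$ as an eigenvalue of $C_n^{(d)}$ equals $g-1$ (multiplicity $0$ meaning that $-1$ is not an eigenvalue).
   Context: $C_n$ denotes the circuit (cycle) graph on $n$ vertices. For a graph $G$ and a positive integer $d$, the $d$-th distance power $G^{(d)}$ is the graph obtained from $G$ by adding edges between all pairs of distinct vertices whose distance in $G$ is at most $d$. The eigenvalues of a graph, and their multiplicities, are those of its adjacency matrix. The condition $1\le d<\frac{n-1}{2}$ expresses that $C_n^{(d)}$ is non-complete. *)

(* Defs.v *)
(* A graph on a finType T is given by its adjacency relation e : rel T. *)
From HB Require Import structures.
From mathcomp Require Import all_boot all_order all_algebra.

Set Implicit Arguments.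
Unset Strict Implicit.
Unset Printing Implicit Defensive.

Import Order.TTheory GRing.Theory Num.Theory.

Local Open Scope ring_scope.

(* The circuit on the vertices 0, ..., n-1; it is loopless and 2-regular only
   for n >= 3. *)
Definition circuit (n : nat) : rel 'I_n :=
  fun i j => (j == ordS i) || (i == ordS j).

Arguments circuit : clear implicits.

Definition has_walk (T : finType) (e : rel T) (x y : T) (k : nat) : bool :=
  [exists p : k.-tuple T, path e x p && (last x p == y)].

(* The length of a shortest path from x to y, always < #|T| when y is reachable
   from x; otherwise the search fails and the value #|T| is meaningless, whence
   the reachability guard in dist_power. *)
Definition graph_dist (T : finType) (e : rel T) (x y : T) : nat :=
  find (has_walk e x y) (iota 0 #|T|).

Definition dist_power (T : finType) (e : rel T) (d : nat) : rel T :=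
  fun x y => e x y
    || [&& x != y, connect e x y & (graph_dist e x y <= d)%N].

Definition adjacency_mx (R : pzSemiRingType) (n : nat) (e : rel 'I_n) : 'M[R]_n :=
  \matrix_(i < n, j < n) (e i j)%:R.

(* Algebraic multiplicity; it is 0 exactly when a is not an eigenvalue. *)
Definition eigen_mult (R : fieldType) (n : nat) (A : 'M[R]_n) (a : R) : nat :=
  mup a (char_poly A).

(* Main.v *)
Require Import Defs.
From mathcomp Require Import all_boot all_order all_algebra all_field.
From mathcomp Require Import zify.

(** Adding the identity to the adjacency matrix of the d-th power of the
    n-circuit turns -1 into the eigenvalue 0 and, as 2d + 1 <= n, gives the
    circulant matrix whose row x is the indicator of the window
    x - d, ..., x + d of residues modulo n
    ([adjacency_dist_power_circuit]).  A circulant is diagonalized by the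
    Fourier matrix of a primitive n-th root of unity w
    ([adjacency_dist_power_circuit_dft]), here with the eigenvalues
    w^(-kd) (1 + w^k + ... + w^(2dk)) for k = 0, ..., n-1.  For k = 0 this is
    2d + 1, which is nonzero in characteristic 0; for 0 < k < n the geometric
    sum is (w^((2d+1)k) - 1) / (w^k - 1), so it vanishes exactly when n divides
    (2d + 1) k ([window_eigenvalue_eq0]).  The multiples of n / g among
    1, ..., n-1, where g = gcd(2d + 1, n), number g - 1 ([sum_dvdn_mul]).

    A real closed field contains no primitive n-th root of unity for n > 2.
    But the matrix has natural number entries, and the multiplicity of a root
    is invariant under field morphisms ([mup_map_poly]), so that the
    computation may be carried over from R, through the rationals, to the field
    of algebraic numbers. *)

Import Order.TTheory GRing.Theory Num.Theory.

Local Open Scope ring_scope.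

Set Implicit Arguments.
Unset Strict Implicit.

(** * Multiplicities of eigenvalues *)

(** Divisibility of polynomials over a field is decided by Euclidean division,
    which commutes with morphisms; hence a power of 'X - a that does not divide
    p still does not divide the image of p over a larger field. *)
Lemma mup_map_poly (F K : fieldType) (f : {rmorphism F -> K}) (a : F)
    (p : {poly F}) : p != 0 -> mup (f a) (map_poly f p) = mup a p.
Proof.
move=> p_neq0; have fp_neq0 : map_poly f p != 0 by rewrite map_poly_eq0.
have geqE m : (m <= mup (f a) (map_poly f p))%N = (m <= mup a p)%N.
  by rewrite !mup_geq // -map_polyXsubC -rmorphXn dvdp_map.
by apply/eqP; rewrite eqn_leq geqE leqnn -geqE leqnn.
Qed.

Lemma eigen_mult_map (F K : fieldType) (f : {rmorphism F -> K}) (n : nat)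
    (A : 'M[F]_n) (a : F) : eigen_mult (map_mx f A) (f a) = eigen_mult A a.
Proof.
rewrite /eigen_mult -map_char_poly mup_map_poly //.
by rewrite monic_neq0 // char_poly_monic.
Qed.

Lemma eigen_mult_adjacency_map (F K : fieldType) (f : {rmorphism F -> K})
    (n : nat) (e : rel 'I_n) :
  eigen_mult (adjacency_mx K e) (-1) = eigen_mult (adjacency_mx F e) (-1).
Proof.
rewrite -(eigen_mult_map f) rmorphN1; congr eigen_mult.
by apply/matrixP=> i j; rewrite !mxE rmorph_nat.
Qed.

Lemma char_poly_diagonalized (F : fieldType) (n : nat) (A V : 'M[F]_n)
    (l : 'rV[F]_n) : V \in unitmx -> A *m V = V *m diag_mx l ->
  char_poly A = \prod_(k < n) ('X - (l 0 k)%:P).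
Proof.
move=> V_unit AV.
have charAV : char_poly_mx A *m map_mx polyC V
            = map_mx polyC V *m char_poly_mx (diag_mx l).
  by rewrite mulmxBl mulmxBr -!map_mxM AV scalar_mxC.
have detV_neq0 : \det (map_mx polyC V) != 0.
  by rewrite det_map_mx polyC_eq0 -unitfE -unitmxE.
have /(congr1 determinant) := charAV; rewrite !det_mulmx mulrC.
move=> /(mulfI detV_neq0); rewrite -!/(char_poly _) => ->.
rewrite char_poly_trig ?diag_mx_is_trig //.
by apply: eq_bigr => k _; rewrite mxE eqxx.
Qed.

(** For a diagonalizable matrix the algebraic multiplicity is thus the number
    of eigenvectors in the eigenbasis with that eigenvalue. *)
Lemma eigen_mult_diagonalized (F : fieldType) (n : nat) (A V : 'M[F]_n)
    (l : 'rV[F]_n) (a : F) : V \in unitmx -> A *m V = V *m diag_mx l ->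
  eigen_mult A a = (\sum_(k < n) (l 0%R k == a))%N.
Proof.
move=> V_unit /(char_poly_diagonalized V_unit) charA.
rewrite /eigen_mult charA -(big_map (l 0) predT (fun b => 'X - b%:P)).
by rewrite mu_prod_XsubC -sum1_count big_map big_mkcond.
Qed.

(** * Counting the solutions of a linear congruence *)

(** With g = gcd(m, n), n divides m k exactly when n / g divides k, and
    1, ..., n contains g multiples of n / g, the last one being n itself. *)
Lemma sum_dvdn_mul (m n : nat) : (0 < n)%N ->
  (\sum_(1 <= k < n) (n %| m * k) = gcdn m n - 1)%N.
Proof.
move=> n_gt0; have g_gt0 : (0 < gcdn m n)%N by rewrite gcdn_gt0 n_gt0 orbT.
set g := gcdn m n in g_gt0 *; set q := (n %/ g)%N.
have nE : n = (q * g)%N by rewrite divnK // dvdn_gcdr.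
have dvdE k : (n %| m * k)%N = (q %| k)%N.
  have -> : (n %| m * k)%N = (n %| g * k)%N.
    by rewrite muln_gcdl dvdn_gcd (dvdn_mulr k (dvdnn n)) andbT.
  by rewrite {1}nE mulnC dvdn_pmul2l.
have q_gt0 : (0 < q)%N by move: n_gt0; rewrite {1}nE muln_gt0 => /andP[].
have q_dvd : (q %| n)%N by rewrite nE dvdn_mulr.
have gE : (n %/ q = g)%N by rewrite {1}nE mulKn.
rewrite -gE divn_count_dvd big_nat_recr //= q_dvd addnK.
by apply: eq_bigr => k _; rewrite dvdE.
Qed.

(** * Distances in the circuit *)

Lemma has_walk0 (T : finType) (e : rel T) (x y : T) :
  has_walk e x y 0 = (x == y).
Proof.
apply/existsP/eqP => [[p]|->]; first by rewrite tuple0 => /eqP.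
by exists [tuple] => /=.
Qed.

Lemma has_walkS (T : finType) (e : rel T) (x y : T) (k : nat) :
  has_walk e x y k.+1 = [exists z, e x z && has_walk e z y k].
Proof.
apply/existsP/existsP => [[p]|[z /andP[exz /existsP[p ep]]]].
  case/tupleP: p => z p /= /andP[/andP[exz ep] lastp]; exists z.
  by rewrite exz; apply/existsP; exists p; rewrite ep.
by exists [tuple of z :: p]; rewrite /= exz.
Qed.

Lemma has_walk_connect (T : finType) (e : rel T) (x y : T) (k : nat) :
  has_walk e x y k -> connect e x y.
Proof.
by case/existsP=> p /andP[ep /eqP lastp]; apply/connectP; exists p.
Qed.

(** A walk on the circuit matters only through its numbers a of forward and b
    of backward steps.  Putting b on the side of y keeps the congruence free of
    subtractions. *)
Lemma has_walk_circuitP (n : nat) (x y : 'I_n) (k : nat) :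
  reflect (exists a b : nat, (a + b = k)%N /\ (x + a = y + b %[mod n])%N)
          (has_walk (circuit n) x y k).
Proof.
elim: k x => [|k IHk] x.
  rewrite has_walk0; apply: (iffP eqP) => [->|[a [b [ab0]]]].
    by exists 0%N, 0%N.
  have [-> ->] : a = 0%N /\ b = 0%N by lia.
  by rewrite !addn0 !modn_small // => /val_inj.
rewrite has_walkS; apply: (iffP existsP).
  case=> z /andP[/orP[/eqP->|/eqP->] /IHk[a [b [<- ab]]]].
    exists a.+1, b; split; first by lia.
    by rewrite -ab /= modnDml addSnnS.
  exists a, b.+1; split; first by lia.
  by rewrite /= modnDml addSn -addn1 -modnDml ab modnDml addn1 addnS.
(* A forward step is peeled off if there is one, else a backward step. *)
case=> -[|a] [b [abk xayb]].
  case: b => [|b] in abk xayb *; first by lia.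
  exists (ord_pred x); rewrite /circuit ord_predK eqxx orbT /=.
  apply/IHk; exists 0%N, b; split; first by lia.
  have xE : ((ord_pred x).+1 %% n)%N = x by have := congr1 val (ord_predK x).
  apply/eqP; rewrite -(eqn_modDr 1) addn0 -addnA !addn1 -xayb addn0.
  by rewrite -xE modn_mod.
exists (ordS x); rewrite /circuit eqxx /=.
apply/IHk; exists a, b; split; first by lia.
by rewrite /= modnDml addSnnS.
Qed.

(** A vertex y is within distance d of x when y = x + (m - d) for some offset
    m - d between -d and d, that is, for some m from 0 to 2d.  Since d < n, the
    search defining [graph_dist] does reach the length d. *)
Lemma dist_power_circuit (n d : nat) (x y : 'I_n) :
  (0 < d)%N -> (2 * d < n)%N ->
  (x == y) || dist_power (circuit n) d x y
    = [exists m : 'I_(2 * d + 1), (x + m == y + d %[mod n])%N].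
Proof.
move=> d_gt0 d_small.
have walkP : reflect (exists2 k, (k <= d)%N & has_walk (circuit n) x y k)
    [exists m : 'I_(2 * d + 1), (x + m == y + d %[mod n])%N].
  apply: (iffP existsP)
    => [[m /eqP xm]|[k kd /has_walk_circuitP[a [b [abk xayb]]]]].
    have m_lt := ltn_ord m.
    have [dm|md] := leqP d m.
      exists (m - d)%N; first by lia.
      apply/has_walk_circuitP; exists (m - d)%N, 0%N; split; first by lia.
      by apply/eqP; rewrite -(eqn_modDr d) addn0 -addnA subnK //; apply/eqP.
    exists (d - m)%N; first by lia.
    apply/has_walk_circuitP; exists 0%N, (d - m)%N; split; first by lia.
    apply/eqP; rewrite -(eqn_modDr m) addn0 -addnA subnK 1?ltnW //.
    exact/eqP.
  (* The net displacement a - b, shifted by d. *)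
  have m_lt : (a + d - b < 2 * d + 1)%N by lia.
  exists (Ordinal m_lt) => /=.
  rewrite -(eqn_modDr b) -addnA subnK; last by lia.
  by rewrite addnA -modnDml xayb modnDml addnAC.
have distE : (graph_dist (circuit n) x y <= d)%N
    = has (has_walk (circuit n) x y) (iota 0 d.+1).
  have d_lt : (d.+1 <= n)%N by lia.
  rewrite -ltnS /graph_dist card_ord -has_take_leq ?size_iota // take_iota.
  by rewrite (minn_idPl d_lt).
apply/orP/walkP => [[/eqP->|/orP[xy|/and3P[_ _]]]|[k kd xky]].
- by exists 0%N; rewrite // has_walk0.
- exists 1%N => //; rewrite has_walkS; apply/existsP; exists y.
  by rewrite xy has_walk0 /=.
- rewrite distE => /hasP[k]; rewrite mem_iota add0n => /andP[_ kd] xky.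
  by exists k.
have [->|x_neq_y] := eqVneq x y; [by left | right].
apply/orP; right; rewrite x_neq_y (has_walk_connect xky) distE.
by apply/hasP; exists k; rewrite // mem_iota.
Qed.

(** For n = 1 the only vertex is its own successor, a loop of the circuit. *)
Lemma dist_power_circuit_irr (n d : nat) (x : 'I_n) : (1 < n)%N ->
  dist_power (circuit n) d x x = false.
Proof.
move=> n_gt1; rewrite /dist_power eqxx /= orbF /circuit orbb -val_eqE /=.
have := ltn_ord x; rewrite leq_eqVlt => /orP[/eqP xn|xn]; last first.
  by rewrite modn_small // ltn_eqF.
by rewrite xn modnn; apply/eqP; lia.
Qed.

(** The sum over m has at most one nonzero term: as 2d + 1 <= n, distinct
    offsets in the window are distinct modulo n.  Without this condition the
    window would overlap itself and the sum could exceed 1. *)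
Lemma adjacency_dist_power_circuit (F : fieldType) (n d : nat) (x y : 'I_n) :
  (0 < d)%N -> (2 * d < n)%N ->
  (adjacency_mx F (dist_power (circuit n) d) + 1%:M) x y
    = \sum_(m < 2 * d + 1) (x + m == y + d %[mod n])%N%:R.
Proof.
move=> d_gt0 d_small; rewrite !mxE.
have -> : (dist_power (circuit n) d x y)%:R + (x == y)%:R
    = ((x == y) || dist_power (circuit n) d x y)%:R :> F.
  have [->|_] /= := eqVneq x y; last by rewrite addr0.
  by rewrite dist_power_circuit_irr ?add0r //; lia.
rewrite dist_power_circuit //; case: existsP => [[m xm]|no_m].
  rewrite (bigD1 m) //= xm big1 ?addr0 // => m' m'_neq.
  case: eqP => // xm'; case/eqP: m'_neq; apply/val_inj => /=.
  move/eqP: xm'; rewrite -(eqP xm) eqn_modDl !modn_small; first by move/eqP.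
    by apply: leq_trans (ltn_ord m) _; lia.
  by apply: leq_trans (ltn_ord m') _; lia.
by rewrite big1 // => m _; case: eqP => // xm; case: no_m; exists m; apply/eqP.
Qed.

(** * Diagonalization by the Fourier matrix *)

Definition dft_mx (F : fieldType) (n : nat) (w : F) : 'M[F]_n :=
  Vandermonde n (\row_k w ^+ k).

Lemma dft_mxE (F : fieldType) (n : nat) (w : F) (i k : 'I_n) :
  dft_mx n w i k = w ^+ (k * i).
Proof. by rewrite !mxE exprM. Qed.

Lemma dft_mx_unit (F : fieldType) (n : nat) (w : F) :
  n.-primitive_root w -> dft_mx n w \in unitmx.
Proof.
move=> w_prim; rewrite unitmxE unitfE det_Vandermonde; apply/prodf_neq0 => i _.
apply/prodf_neq0 => j ij; rewrite !mxE subr_eq0 (eq_prim_root_expr w_prim).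
by rewrite !modn_small // gtn_eqF.
Qed.

Lemma prim_root_neq0 (F : fieldType) (n : nat) (w : F) :
  n.-primitive_root w -> w != 0.
Proof.
move=> w_prim; apply/eqP=> w0; have := prim_expr_order w_prim.
rewrite w0 expr0n eqn0Ngt (prim_order_gt0 w_prim) /=.
by apply/eqP; rewrite eq_sym oner_eq0.
Qed.

(** The k-th Fourier coefficient of the window -d, ..., d; the factor
    w ^- (k * d) shifts the window 0, ..., 2d back to its centre. *)
Definition window_eigenvalue (F : fieldType) (w : F) (d k : nat) : F :=
  w ^- (k * d) * \sum_(m < 2 * d + 1) w ^+ (k * m).

(** Column k of the Fourier matrix is the character j |-> w^(k j) of Z/nZ.
    Summing it over a translate of the window multiplies it by a constant,
    because translation by m multiplies it by w^(k m). *)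
Lemma adjacency_dist_power_circuit_dft (F : fieldType) (n : nat) (w : F)
    (d : nat) :
  n.-primitive_root w -> (0 < d)%N -> (2 * d < n)%N ->
  adjacency_mx F (dist_power (circuit n) d) *m dft_mx n w
    = dft_mx n w *m diag_mx (\row_k (window_eigenvalue w d k - 1)).
Proof.
move=> w_prim d_gt0 d_small; set A := adjacency_mx _ _.
(* Adding the identity to both sides removes the - 1 from the eigenvalues. *)
suff AV : (A + 1%:M) *m dft_mx n w
    = dft_mx n w *m diag_mx (\row_k window_eigenvalue w d k).
  apply: (addIr (dft_mx n w)); rewrite -{2}[dft_mx n w]mul1mx -mulmxDl AV.
  rewrite -{3}[dft_mx n w]mulmx1 -mulmxDr; congr (_ *m _).
  by apply/matrixP=> i j; rewrite !mxE -mulrnDl subrK.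
apply/matrixP=> i k; rewrite mul_mx_diag !mxE -exprM mulrCA.
(* Multiplying by w ^+ (k * d) clears the negative exponent. *)
have wkd_unit : w ^+ (k * d) \is a GRing.unit.
  by rewrite unitfE expf_neq0 ?(prim_root_neq0 w_prim).
apply: (mulrI wkd_unit); rewrite mulVKr // !mulr_sumr.
under eq_bigr => j _.
  rewrite adjacency_dist_power_circuit // dft_mxE mulrCA -exprD -mulnDr.
  rewrite mulr_suml.
  over.
rewrite exchange_big /=; apply: eq_bigr => m _.
have n_gt0 := prim_order_gt0 w_prim.
(* The representative below n of i + m - d, the one vertex that the offset m
   contributes. *)
pose j : 'I_n := Ordinal (ltn_pmod (i + m + (n - d)) n_gt0).
have jE : (j + d = i + m %[mod n])%N.
  rewrite modnDml -addnA subnK; last by lia.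
  by rewrite modnDr.
rewrite (bigD1 j) //= big1 ?addr0 => [|j' j'_neq].
  rewrite -jE eqxx mul1r -exprD -mulnDr.
  apply/eqP; rewrite (eq_prim_root_expr w_prim) -modnMmr addnC jE.
  by rewrite modnMmr.
case: eqP => [ij'|]; last by rewrite mul0r.
case/eqP: j'_neq; apply/val_inj; move/eqP: ij'.
rewrite -jE eqn_modDr (modn_small (ltn_ord j)) (modn_small (ltn_ord _)).
by move/eqP.
Qed.

Lemma window_eigenvalue_eq0 (F : fieldType) (n : nat) (w : F) (d k : nat) :
  n.-primitive_root w -> (2 * d + 1)%:R != 0 :> F ->
  (k < n)%N ->
  (window_eigenvalue w d k == 0) = (0 < k)%N && (n %| (2 * d + 1) * k)%N.
Proof.
move=> w_prim d_neq0 kn; rewrite /window_eigenvalue mulf_eq0 invr_eq0.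
rewrite expf_eq0 (negPf (prim_root_neq0 w_prim)) andbF /=.
have [->|k_gt0] /= := posnP k.
  under eq_bigr do rewrite mul0n expr0.
  by rewrite sumr_const card_ord (negPf d_neq0).
under eq_bigr do rewrite exprM.
have wk_neq1 : w ^+ k - 1 != 0.
  by rewrite subr_eq0 -(prim_order_dvd w_prim) gtnNdvd.
rewrite -(mulrI_eq0 _ (mulfI wk_neq1)) -subrX1 subr_eq0 -exprM.
by rewrite -(prim_order_dvd w_prim) mulnC.
Qed.

Unset Implicit Arguments.

Theorem theorem5 (R : rcfType) (n d : nat)
    (n_gt0 : (0 < n)%N) (d_ge1 : (1 <= d)%N)
    (d_lt : (d%:R : R) < (n%:R - 1) / 2%:R) :
  eigen_mult (adjacency_mx R (dist_power (circuit n) d)) (-1)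
    = (gcdn (2 * d + 1) n - 1)%N.
Proof.
have d_small : (2 * d < n)%N.
  move: d_lt; rewrite ltr_pdivlMr ?ltr0n // ltrBrDr -natrM natr1 ltr_nat.
  by move=> ?; lia.
rewrite (eigen_mult_adjacency_map (@ratr R)).
rewrite -(eigen_mult_adjacency_map (@ratr algC)).
have [w w_prim] := C_prim_root_exists n_gt0.
rewrite (eigen_mult_diagonalized _ (dft_mx_unit w_prim)
  (adjacency_dist_power_circuit_dft w_prim d_ge1 d_small)).
have lE (k : 'I_n) : ((\row_k (window_eigenvalue w d k - 1)) 0%R k == -1)
    = ((0 < k) && (n %| (2 * d + 1) * k))%N.
  rewrite mxE -subr_eq0 opprK subrK (window_eigenvalue_eq0 w_prim) //.
  by rewrite pnatr_eq0 addn1.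
under eq_bigr do rewrite lE.
rewrite -(big_mkord xpredT
  (fun k => ((0 < k) && (n %| (2 * d + 1) * k) : nat)%N)).
rewrite big_ltn // add0n -sum_dvdn_mul //.
by apply: eq_big_nat => k /andP[->].
Qed.
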